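(* Let $p$ be an odd prime, let $q\in\mathbb{C}_p$ with $|1-q|_p<p^{-1/(p-1)}$, and let $h\in\mathbb{N}$. Let $s\in\mathbb{N}$ with $s\ge 2$, and let $n_1,n_2,\dots,n_s,k\in\mathbb{N}^{\ast}$ with $\sum_{l=1}^{s}n_l>sk$. Then $$\sum_{l=0}^{n_1+\cdots+n_s-sk}\binom{\sum_{d=1}^{s}(n_d-k)}{l}(-1)^l\frac{G_{l+sk+1,q}^{(h)}}{l+sk+1}=\begin{cases}[2]_q+\dfrac{q^{h+1}}{n_1+\cdots+n_s+1}G_{n_1+\cdots+n_s+1,q^{-1}}^{(h)} & \text{if } k=0,\\[2mm] \displaystyle\sum_{l=0}^{sk}\binom{sk}{l}(-1)^{sk+l}\left([2]_q+\frac{q^{h+1}}{n_1+\cdots+n_s-l+1}G_{n_1+\cdots+n_s-l+1,q^{-1}}^{(h)}\right) & \text{if } k\neq0.\end{cases}$$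
   Context: Here $\mathbb{N}=\{1,2,\dots\}$, $\mathbb{N}^{\ast}=\mathbb{N}\cup\{0\}$; $\mathbb{C}_p$ is the completion of an algebraic closure of $\mathbb{Q}_p$ with absolute value normalized by $|p|_p=p^{-1}$. For $|x|_p\le 1$, $q^x=\exp(x\log q)$. Put $[x]_q=\frac{1-q^x}{1-q}$ (with $[x]_1=x$), so $[2]_q=1+q$, and $[x]_{-q}=\frac{1-(-q)^x}{1+q}$ for $x\in\mathbb{N}$. The fermionic $p$-adic $q$-integral of a uniformly differentiable $f:\mathbb{Z}_p\to\mathbb{C}_p$ is $$\int_{\mathbb{Z}_p}f(x)\,d\mu_{-q}(x)=\lim_{N\to\infty}\frac{1}{[p^N]_{-q}}\sum_{x=0}^{p^N-1}(-1)^xf(x)q^x.$$ The $(h,q)$-Genocchi polynomials are defined by $G_{0,q}^{(h)}(x)=0$ and $\frac{G_{n+1,q}^{(h)}(x)}{n+1}=\int_{\mathbb{Z}_p}q^{(h-1)y}[x+y]_q^n\,d\mu_{-q}(y)$ for $n\in\mathbb{N}^{\ast}$, $x\in\mathbb{Z}_p$; the $(h,q)$-Genocchi numbers are $G_{n,q}^{(h)}=G_{n,q}^{(h)}(0)$. $G_{n,q^{-1}}^{(h)}$ is obtained by replacing $q$ by $q^{-1}$ throughout. *)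

(* Defs.v *)
From HB Require Import structures.
From mathcomp Require Import all_boot all_order all_algebra.
From mathcomp Require Import all_classical all_reals all_analysis.

Set Implicit Arguments.
Unset Strict Implicit.
Unset Printing Implicit Defensive.

Import Order.TTheory GRing.Theory Num.Theory.

Local Open Scope classical_set_scope.
Local Open Scope ring_scope.

(* The norm classes of the library require |x *+ n| = |x| *+ n, which no
   non-archimedean absolute value satisfies, hence a separate structure. *)
HB.mixin Record Field_isUltrametric (R : realType) K & GRing.Field K := {
  absv : K -> R ;
  absv_ge0 : forall x, 0 <= absv x ;
  absv_eq0 : forall x, (absv x == 0) = (x == 0) ;
  absvM : forall x y, absv (x * y) = absv x * absv y ;
  absvD_le_max : forall x y, absv (x + y) <= Num.max (absv x) (absv y)
}.

#[short(type="ultrametricFieldType")]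
HB.structure Definition UltrametricField (R : realType) :=
  {K of GRing.Field K & Field_isUltrametric R K}.

Section UltrametricTopology.
Context (R : realType) (K : ultrametricFieldType R).
Implicit Types x y z : K.

Lemma absv0 : absv (0 : K) = 0 :> R.
Proof. by apply/eqP; rewrite absv_eq0. Qed.

Lemma absv1 : absv (1 : K) = 1 :> R.
Proof.
have n0 : absv (1 : K) != 0 :> R by rewrite absv_eq0 oner_eq0.
by apply: (mulfI n0); rewrite -absvM !mulr1.
Qed.

Lemma absvN x : absv (- x) = absv x :> R.
Proof.
have b2 : (absv (-1 : K) : R) ^+ 2 = 1 by rewrite expr2 -absvM mulrNN mulr1 absv1.
have b1 : absv (-1 : K) = 1 :> R.
  by apply/eqP; rewrite -(eqrXn2 (n := 2)) ?absv_ge0 ?ler01// b2 expr1n.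
by rewrite -mulN1r absvM b1 mul1r.
Qed.

Let dist x y : R := absv (x - y).

Let distxx x : dist x x = 0. Proof. by rewrite /dist subrr absv0. Qed.

Let dist_positivity x y : dist x y = 0 -> x = y.
Proof. by move/eqP; rewrite absv_eq0 subr_eq0 => /eqP. Qed.

Let dist_sym x y : dist x y = dist y x.
Proof. by rewrite /dist -opprB absvN. Qed.

Let dist_triangle y x z : dist x z <= dist x y + dist y z.
Proof.
rewrite /dist -[X in absv X](subrKA y) (le_trans (absvD_le_max _ _))//.
by rewrite ge_max lerDl lerDr !absv_ge0.
Qed.

HB.instance Definition _ := isPointed.Build K 0.
HB.instance Definition _ := @isMetric.Build R K
  dist distxx dist_positivity dist_sym dist_triangle.

End UltrametricTopology.

Section PadicComplex.
Context (p : nat) (R : realType) (K : ultrametricFieldType R).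

(* When |p| = 1/p, the absolute value restricts to the p-adic one on the
   rationals (Ostrowski); if moreover K is complete, the closure of the
   rationals in K is a completion of them, i.e. the field Q_p. *)
Definition Qp : set K := closure (range (@ratr K)).

Definition Qpbar : set K :=
  [set x | exists P : {poly K},
     [/\ P != 0, forall i, Qp P`_i & root P x]].

(* K is a completion of an algebraic closure of Q_p. *)
Record is_padic_complex : Prop := {
  absv_p : absv (p%:R : K) = (p%:R)^-1 :> R ;
  padic_complete : forall F : set_system K, ProperFilter F -> cauchy F -> cvg F ;
  Qpbar_root : forall P : {poly K}, (forall i, Qp P`_i) -> (1 < size P)%N ->
    exists2 x, Qpbar x & root P x ;
  Qpbar_dense : dense Qpbar
}.

End PadicComplex.

(* lim is total: it is meaningful only where the
   sequence converges. *)
Section QAnalysis.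
Context (p : nat) (R : realType) (K : ultrametricFieldType R).
Implicit Types (q x : K) (f : K -> K) (n h : nat).

Definition padic_exp x : K := limn (series (fun n : nat => x ^+ n / n`!%:R)).

Definition padic_log x : K :=
  limn (fun N : nat =>
    \sum_(1 <= n < N) ((-1) ^+ n.+1 * (x - 1) ^+ n / n%:R)).

(* q^x for |x| <= 1 *)
Definition qpow q x : K := padic_exp (x * padic_log q).

(* [x]_q *)
Definition qnum q x : K := if q == 1 then x else (1 - qpow q x) / (1 - q).

(* [n]_{-q} for a natural number n *)
Definition qnum_neg q n : K := (1 - (- q) ^+ n) / (1 + q).

(* The integral only evaluates f at natural numbers, so a function on Z_p may
   be given by any extension of it to K. *)
Definition fermionic_integral q f : K :=
  limn (fun N : nat => (qnum_neg q (p ^ N))^-1 *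
    \sum_(0 <= x < p ^ N) ((-1) ^+ x * f x%:R * q ^+ x)).

(* G_{n,q}^{(h)}(x), for x in Z_p *)
Definition genocchi_poly h n q x : K :=
  if n is m.+1 then
    m.+1%:R * fermionic_integral q
      (fun y => qpow q ((h%:R - 1) * y) * qnum q (x + y) ^+ m)
  else 0.

Definition genocchi h n q : K := genocchi_poly h n q 0.

End QAnalysis.

(* Main.v *)
Require Import Defs.
From mathcomp Require Import all_boot all_order all_algebra.
From mathcomp Require Import all_classical all_reals all_analysis.
From mathcomp Require Import ring zify.

Set Implicit Arguments.
Unset Strict Implicit.
Unset Printing Implicit Defensive.

Import Order.TTheory GRing.Theory Num.Theory numFieldNormedType.Exports.

Local Open Scope classical_set_scope.
Local Open Scope ring_scope.

(** Write E(f) for the p-adic limit of the alternating sums of (-1)^x f(x) over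
    0 <= x < p^N, and [x]_q for 1 + q + ... + q^(x-1).

    On natural numbers the analytic q^x, defined through exp and log, is the
    ordinary power (qpow_nat), so [x]_q has its elementary meaning.  As
    [p^N]_{-q} tends to 2 / (1 + q), the fermionic integral of f is
    (1 + q) / 2 times E(f(x) q^x) (fermionic_integralE), and therefore
    G_{n+1,q} / (n+1) = (1 + q) / 2 * E(q^(hx) [x]_q^n) (genocchiE).

    Two symmetries of E are used, both valid because p^N is odd:
    E(f(x+1)) = 2 f(0) - E(f) (alt_lim_shift), and E(f(-1-x)) = E(f)
    (alt_lim_reflect).  Put Q = 1/q.  Replacing x by -1-x turns
    q^(hx) (1 - [x]_q)^n into q^h u(x+2), where u(x) = Q^(hx) [x]_Q^n.
    Two shifts bring u(x+2) back to u(x), and since u(0) = 0 for n > 0 and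
    u(1) = q^-h they give
      E(q^(hx) (1 - [x]_q)^n) = 2 + q^h E(u)   (alt_lim_qint_reflect),
    that is, in terms of Genocchi numbers,
      (1 + q) / 2 * E(q^(hx) (1 - [x]_q)^n)
        = [2]_q + q^(h+1) G_{n+1,1/q} / (n+1)   (integral_qint_compl).

    With a = sk and D = n_1 + ... + n_s, both sides of the theorem are expansions
    of (1 + q) / 2 * E(q^(hx) [x]_q^a (1 - [x]_q)^(D-a)): the left one expands the
    power of 1 - [x]_q by the binomial theorem (sum_binX_subr), the right one
    expands [x]_q^a = (1 - (1 - [x]_q))^a (sum_bin_subrX) and applies the
    reflection formula to each term, whose exponent D - l is positive because
    D > a.  For k = 0 the second sum has a single term.

    The analytic input is that all these limits exist, and that
    exp(m log q) = q^m.  Existence holds because the integrands change by at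
    most rho^N when x grows by p^N, for a fixed rho < 1 (padic_lip).  The
    exponential identity is proved on truncated series: as polynomials they
    agree with (1 + X)^m to high order (coef_exp_log_trunc), and the Gauss norm
    at radius p^(-1/(p-1)) bounds the remaining coefficients. *)

(** * Ultrametric absolute values *)

Section AbsoluteValue.
Context {R : realType} {K : ultrametricFieldType R}.
Implicit Types (x y : K) (B : R) (n : nat).

Lemma absvX x n : absv (x ^+ n) = absv x ^+ n :> R.
Proof. by elim: n => [|n IHn]; rewrite ?expr0 ?absv1// !exprS absvM IHn. Qed.

Lemma absvV x : absv x^-1 = (absv x)^-1 :> R.
Proof.
have [->|x0] := eqVneq x 0; first by rewrite invr0 absv0 invr0.
have a0 : absv x != 0 :> R by rewrite absv_eq0.
by apply: (mulfI a0); rewrite -absvM !divff// absv1.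
Qed.

Lemma absv_sign n : absv ((-1) ^+ n : K) = 1 :> R.
Proof. by rewrite absvX absvN absv1 expr1n. Qed.

Lemma absv_distC x y : absv (x - y) = absv (y - x) :> R.
Proof. by rewrite -absvN opprB. Qed.

Lemma absvD_le x y B : absv x <= B -> absv y <= B -> absv (x + y) <= B.
Proof. by move=> xB yB; rewrite (le_trans (absvD_le_max _ _))// ge_max xB. Qed.

Lemma absvB_le x y B : absv x <= B -> absv y <= B -> absv (x - y) <= B.
Proof. by move=> xB yB; apply: absvD_le => //; rewrite absvN. Qed.

Lemma absvD_triangle x y : absv (x + y) <= absv x + absv y :> R.
Proof. by apply: absvD_le; rewrite ?lerDl ?lerDr absv_ge0. Qed.

Lemma absv_sum_le (I : Type) (s : seq I) (P : pred I) (F : I -> K) B :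
  0 <= B -> (forall i, P i -> absv (F i) <= B) ->
  absv (\sum_(i <- s | P i) F i) <= B.
Proof.
move=> B0 FB; elim/big_ind: _ => //; first by rewrite absv0.
by move=> x y; apply: absvD_le.
Qed.

Lemma absvM_le1 x y : absv x <= 1 :> R -> absv y <= 1 :> R ->
  absv (x * y) <= 1 :> R.
Proof. by move=> x1 y1; rewrite absvM mulr_ile1 ?absv_ge0. Qed.

Lemma absv_nat_le1 n : absv (n%:R : K) <= 1 :> R.
Proof.
by elim: n => [|n IHn]; rewrite ?absv0// -natr1 absvD_le// absv1.
Qed.

(** A term that is strictly smaller does not change the absolute value: with
    the larger summand 1, this is what makes 1 + x a unit. *)
Lemma absv_1D x : absv x < 1 :> R -> absv (1 + x) = 1 :> R.
Proof.
move=> x1; apply/eqP; rewrite eq_le absvD_le ?absv1 ?(ltW x1)//= leNgt.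
apply/negP => h; have : absv (1 + x - x) < 1 :> R.
  by rewrite (le_lt_trans (absvD_le_max _ _))// gt_max h absvN.
by rewrite addrK absv1 ltxx.
Qed.

Lemma absv_subX_le x y B n : absv x <= B -> absv y <= B ->
  absv (x ^+ n.+1 - y ^+ n.+1) <= absv (x - y) * B ^+ n.
Proof.
move=> xB yB; have B0 : 0 <= B by rewrite (le_trans (absv_ge0 x)).
rewrite subrXX absvM ler_wpM2l ?absv_ge0// absv_sum_le ?exprn_ge0// => i _.
rewrite absvM !absvX -[in leRHS](subnK (ltn_ord i : (i <= n)%N)) exprD.
by rewrite ler_pM ?exprn_ge0 ?absv_ge0// lerXn2r ?nnegrE ?absv_ge0.
Qed.

Lemma absv_subM_le B (a b c d : K) :
  absv b <= 1 :> R -> absv c <= 1 :> R ->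
  absv (a - c) <= B -> absv (b - d) <= B -> absv (a * b - c * d) <= B.
Proof.
move=> b1 c1 ac bd.
have -> : a * b - c * d = (a - c) * b + c * (b - d) by ring.
apply: absvD_le; rewrite absvM.
  by rewrite -[leRHS]mulr1 ler_pM ?absv_ge0.
by rewrite -[leRHS]mul1r ler_pM ?absv_ge0.
Qed.

End AbsoluteValue.

(** * Limits in an ultrametric field *)

Section Limits.
Context {R : realType} {K : ultrametricFieldType R}.
Implicit Types (u v : nat -> K) (l m : K).

Lemma cvg_absvP u l :
  u @ \oo --> l <-> (fun n => absv (u n - l)) @ \oo --> (0 : R).
Proof.
split=> [/cvg_ballP ul|/cvgrPdist_lt ul].
  apply/cvgrPdist_lt => e e0; have := ul e e0; apply: filterS => n.
  by rewrite ballEmdist /= sub0r normrN ger0_norm ?absv_ge0// absv_distC.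
apply/cvg_ballP => e e0; have := ul e e0; apply: filterS => n.
by rewrite ballEmdist /= sub0r normrN ger0_norm ?absv_ge0// absv_distC.
Qed.

Lemma absv_cvg_bound u l (e : nat -> R) :
  (forall n, absv (u n - l) <= e n) -> e @ \oo --> (0 : R) -> u @ \oo --> l.
Proof.
move=> ue e0; apply/cvg_absvP.
apply: (squeeze_cvgr _ (cvg_cst (0 : R)) e0).
by apply: nearW => n; rewrite absv_ge0 ue.
Qed.

Lemma absv_limn u l : u @ \oo --> l -> limn u = l.
Proof. exact/cvg_lim/metric_hausdorff. Qed.

Lemma absv_cvgD u v l m :
  u @ \oo --> l -> v @ \oo --> m -> (fun n => u n + v n) @ \oo --> l + m.
Proof.
move=> /cvg_absvP ul /cvg_absvP vm.
apply: (@absv_cvg_bound _ _ (fun n => absv (u n - l) + absv (v n - m))).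
  by move=> n; rewrite opprD addrACA absvD_triangle.
by rewrite -[0]addr0; apply: cvgD.
Qed.

Lemma absv_cvgM u v l m :
  u @ \oo --> l -> v @ \oo --> m -> (fun n => u n * v n) @ \oo --> l * m.
Proof.
move=> /cvg_absvP ul /cvg_absvP vm.
apply: (@absv_cvg_bound _ _ (fun n => absv (u n - l) * absv (v n - m) +
    (absv l * absv (v n - m) + absv m * absv (u n - l)))).
  move=> n; rewrite -!absvM.
  have -> : u n * v n - l * m =
      (u n - l) * (v n - m) + (l * (v n - m) + m * (u n - l)) by ring.
  by rewrite (le_trans (absvD_triangle _ _))// lerD2l absvD_triangle.
have -> : (0 : R) = 0 * 0 + (absv l * 0 + absv m * 0) by rewrite !mulr0 !addr0.
by apply: cvgD; [apply: cvgM|apply: cvgD; apply: cvgM => //; apply: cvg_cst].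
Qed.

Lemma absv_cvgZ (c : K) u l :
  u @ \oo --> l -> (fun n => c * u n) @ \oo --> c * l.
Proof. by apply: absv_cvgM; apply: cvg_cst. Qed.

Lemma absv_cvg_sum (I : Type) (s : seq I) (u : I -> nat -> K) (l : I -> K) :
  (forall i, u i @ \oo --> l i) ->
  (fun n => \sum_(i <- s) u i n) @ \oo --> \sum_(i <- s) l i.
Proof.
move=> ul; elim: s => [|i s IHs].
  rewrite big_nil; apply: (absv_cvg_bound (e := fun=> 0)) => [n|].
    by rewrite big_nil subrr absv0.
  exact: cvg_cst.
rewrite big_cons; under eq_fun do rewrite big_cons.
exact: absv_cvgD.
Qed.

Lemma absv_cvg_le u l (B : R) :
  u @ \oo --> l -> (forall n, absv (u n) <= B) -> absv l <= B.
Proof.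
move=> /cvg_absvP/cvgrPdist_lt ul uB; apply/ler_addgt0Pr => e e0.
have [n _ /(_ n (leqnn n))] := ul e e0.
rewrite sub0r normrN ger0_norm ?absv_ge0// absv_distC => ne.
rewrite -(subrK (u n) l) addrC (le_trans (absvD_triangle _ _))//.
by rewrite lerD// ltW.
Qed.

(** In an ultrametric space the Cauchy condition only concerns consecutive
    terms. *)
Lemma absv_is_cvg u (e : nat -> R) :
  (forall F : set_system K, ProperFilter F -> cauchy F -> cvg F) ->
  (forall n, absv (u n.+1 - u n) <= e n) -> e @ \oo --> (0 : R) -> cvgn u.
Proof.
move=> K_complete ue /cvgrPdist_lt e0; apply: K_complete; apply/cauchy_exP.
move=> d d0; have [N _ dN] := e0 d d0.
exists (u N); exists N => // n /= Nn; rewrite ballEmdist /=.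
rewrite -(subnKC Nn); elim: (n - N)%N => [|k IHk]; first by rewrite addn0 mdistxx.
have -> : mdist (u N) (u (N + k.+1)%N) =
    absv (u N - u (N + k)%N + (u (N + k)%N - u (N + k).+1)) :> R.
  by rewrite subrKA addnS.
rewrite (le_lt_trans (absvD_le_max _ _))// gt_max IHk absv_distC /=.
rewrite (le_lt_trans (ue _))//.
have := dN _ (leq_addr k N); rewrite sub0r normrN.
exact/le_lt_trans/ler_norm.
Qed.

End Limits.

(** * The p-adic size of factorials *)

(** Legendre's formula is a sum of floors; p floor(m/p) <= m makes it telescope
    against n, and the last nonzero floor leaves the strict inequality. *)
Lemma logn_fact_lt p n : prime p -> (0 < n)%N -> (p.-1 * logn p n`! < n)%N.
Proof.
move=> p_prime n_gt0; rewrite logn_fact//.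
(* K ranges over the truncations of the sum; the first component is the
   telescoped bound as long as the floor is nonzero. *)
suff H K : (0 < n %/ p ^ K -> p.-1 * (\sum_(1 <= k < K.+1) n %/ p ^ k) +
    n %/ p ^ K <= n)%N /\ (p.-1 * (\sum_(1 <= k < K.+1) n %/ p ^ k) < n)%N.
  by have [] := H n.
have p_gt0 := prime_gt0 p_prime.
elim: K => [|K [IH1 IH2]]; first by rewrite big_geq// muln0 expn0 divn1.
rewrite big_nat_recr//= expnSr divnMA.
have := leq_trunc_div (n %/ p ^ K) p; move: IH1 IH2.
move: (n %/ p ^ K)%N (\sum_(1 <= _ < _) _)%N => a b.
have [->|] := posnP (a %/ p)%N; first by rewrite !addn0; split.
move: (a %/ p)%N => c c_gt0 IH1 IH2 ca.
have a_gt0 : (0 < a)%N by rewrite (leq_trans _ ca)// muln_gt0 c_gt0.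
have {}IH1 := IH1 a_gt0.
suff H : (p.-1 * (b + c) + c <= n)%N.
  by split=> //; lia.
rewrite mulnDr -addnA -mulSnr prednK// (leq_trans _ IH1)// leq_add2l.
by rewrite mulnC.
Qed.

Section PadicNorm.
Context {R : realType} {K : ultrametricFieldType R} {p : nat}.
Hypotheses (p_prime : prime p) (absvp : absv (p%:R : K) = (p%:R)^-1 :> R).

Lemma invp_lt1 : (p%:R)^-1 < 1 :> R.
Proof. by rewrite invf_lt1 ?ltr0n ?ltr1n ?prime_gt0// prime_gt1. Qed.

(** A Bezout relation u m = 1 + v p makes u m a unit, and neither factor has
    absolute value above 1. *)
Lemma absv_nat_coprime m : coprime p m -> absv (m%:R : K) = 1 :> R.
Proof.
move=> pm; have m0 : (0 < m)%N.
  rewrite lt0n; apply: contraTneq pm => ->.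
  by rewrite /coprime gcdn0 gtn_eqF ?prime_gt1.
have [u v uv _] := egcdnP p m0.
apply/eqP; rewrite eq_le absv_nat_le1 /=.
rewrite coprime_sym in pm; rewrite (eqP pm) in uv.
have uvK : u%:R * m%:R = 1 + v%:R * p%:R :> K.
  by rewrite -!natrM uv natrD addrC.
have <- : absv (u%:R * m%:R : K) = 1 :> R.
  rewrite uvK absv_1D// absvM absvp.
  by rewrite (le_lt_trans _ invp_lt1)// ler_piMl ?absv_nat_le1// invr_ge0.
by rewrite absvM ler_piMl ?absv_ge0 ?absv_nat_le1.
Qed.

Lemma absv_nat n : (0 < n)%N -> absv (n%:R : K) = (p%:R)^-1 ^+ logn p n :> R.
Proof.
move=> n0; have [m pm {1}->] := pfactor_coprime p_prime n0.
by rewrite natrM natrX absvM absvX absvp absv_nat_coprime// mul1r.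
Qed.

Lemma natr_neq0 n : (n.+1%:R : K) != 0.
Proof.
rewrite -(absv_eq0 (s:=K)) absv_nat// expf_neq0// invr_eq0 pnatr_eq0.
by rewrite -lt0n prime_gt0.
Qed.

(** The radius of convergence of the p-adic exponential. *)
Definition exp_radius : R := p%:R `^ (- (1 / (p%:R - 1))).

Lemma exp_radius_gt0 : 0 < exp_radius.
Proof. by rewrite powR_gt0// ltr0n prime_gt0. Qed.

Lemma exp_radiusX : exp_radius ^+ p.-1 = (p%:R)^-1.
Proof.
have p1 := prime_gt1 p_prime.
rewrite -powR_mulrn ?powR_ge0// -powRrM -subn1 natrB ?(ltnW p1)//.
rewrite mulNr div1r mulVf ?powR_inv1 ?ler0n//.
by rewrite subr_eq0 -[1]/(1%:R) eqr_nat; case: p p1 => [|[]].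
Qed.

Lemma exp_radius_lt1 : exp_radius < 1.
Proof.
have := invp_lt1; rewrite -exp_radiusX expr_lt1 ?ltW ?exp_radius_gt0//.
by rewrite -ltnS prednK ?prime_gt1 ?prime_gt0.
Qed.

(** The shift by one in the index matters: at |x| < r it makes the terms of
    degree n + 1 of the exponential and the logarithm at most |x|. *)
Lemma absv_fact_ge n : exp_radius ^+ n <= absv (n.+1`!%:R : K).
Proof.
rewrite absv_nat ?fact_gt0// -exp_radiusX -exprM.
have := logn_fact_lt p_prime (ltn0Sn n); rewrite ltnS => vn.
by rewrite ler_wiXn2l// ltW ?exp_radius_gt0 ?exp_radius_lt1.
Qed.

End PadicNorm.

(** * Exponential of the logarithm, formally *)

Section ExpLogPolynomials.
Context {K : fieldType}.
Hypothesis natr_neq0 : forall n, n.+1%:R != 0 :> K.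
Implicit Types (A : {poly K}) (m n i : nat).

Definition exp_trunc n A : {poly K} := \sum_(k < n) (k`!%:R)^-1 *: A ^+ k.

(** The Taylor polynomial of log (1 + X). *)
Definition log_trunc n : {poly K} :=
  \sum_(k < n) ((-1) ^+ k / k.+1%:R) *: 'X^(k.+1).

Lemma deriv_log_trunc n : (1 + 'X) * (log_trunc n)^`() = 1 - (- 'X) ^+ n.
Proof.
rewrite /log_trunc; elim: n => [|n IHn].
  by rewrite big_ord0 deriv0 mulr0 expr0 subrr.
rewrite big_ord_recr/= derivD mulrDr IHn derivZ derivXn -scaler_nat scalerA.
rewrite -mulrA mulVf// mulr1 -mul_polyC polyC_exp polyCN polyC1.
by rewrite !(exprNn 'X) !exprS; ring.
Qed.

Lemma deriv_exp_trunc n A :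
  (exp_trunc n.+1 A)^`() = A^`() * exp_trunc n A.
Proof.
rewrite /exp_trunc big_ord_recl /= derivD expr0 derivZ -polyC1 derivC.
rewrite scaler0 add0r raddf_sum mulr_sumr /=; apply: eq_bigr => k _.
rewrite derivZ deriv_exp /= -scaler_nat scalerA -scalerAr; congr (_ *: _).
rewrite factS natrM invfM mulrAC mulVf ?mul1r//.
Qed.

(** The differential equation (1 + X) F' = m F of (1 + X)^m holds up to order n,
    because the truncations only discard multiples of X^n. *)
Lemma exp_log_trunc_ode m n : exists Q,
  let F := exp_trunc n.+1 (m%:R *: log_trunc n) in
  (1 + 'X) * F^`() = m%:R *: F + 'X^n * Q.
Proof.
set A := _ *: _.
have [A1 AE] : exists A1, A = 'X * A1.
  exists (m%:R *: \sum_(k < n) ((-1) ^+ k / k.+1%:R) *: 'X^k).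
  rewrite /A -scalerAr mulr_sumr; congr (_ *: _); apply: eq_bigr => k _.
  by rewrite -scalerAr exprS.
pose F := exp_trunc n.+1 A; pose c : {poly K} := (n`!%:R)^-1%:P.
have FE : exp_trunc n A = F - c * ('X^n * A1 ^+ n).
  by rewrite /F /exp_trunc big_ord_recr /= AE exprMn -mul_polyC addrK.
have LE : (1 + 'X) * A^`() = m%:R *: (1 - (-1) ^+ n * 'X^n).
  by rewrite derivZ -scalerAr deriv_log_trunc -exprMn mulN1r.
exists (m%:R *: (- c * A1 ^+ n * (1 - (-1) ^+ n * 'X^n) - (-1) ^+ n * F)) => /=.
rewrite deriv_exp_trunc mulrA LE FE -/F -!mul_polyC; ring.
Qed.

(** Comparing coefficients in (1 + X) F' = m F gives
    (i + 1) F_(i+1) = (m - i) F_i, the recursion of the binomial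
    coefficients. *)
Lemma coef_exp_log_trunc m n i : (i <= n)%N ->
  (exp_trunc n.+1 (m%:R *: log_trunc n))`_i = 'C(m, i)%:R.
Proof.
have [Q] := exp_log_trunc_ode m n; set F := exp_trunc _ _ => /= ode.
elim: i => [|i IHi] lin.
  rewrite bin0 /F /exp_trunc -horner_coef0 horner_sum big_ord_recl big1.
    by rewrite expr0 fact0 invr1 scale1r hornerC addr0.
  move=> k _; rewrite hornerZ horner_exp hornerZ /log_trunc horner_sum big1.
    by rewrite mulr0 expr0n mulr0.
  by move=> j _; rewrite hornerZ hornerXn expr0n mulr0.
have Fi := IHi (ltnW lin).
have := congr1 (fun P : {poly K} => P`_i) ode.
rewrite coefD coefZ coefXnM lin addr0 mulrDl mul1r coefD coefXM coef_deriv Fi.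
have -> : (if i == 0%N then 0 else F^`()`_i.-1) = 'C(m, i)%:R *+ i.
  case: i lin IHi Fi => [|i] lin IHi Fi /=; first by rewrite mulr0n.
  by rewrite coef_deriv Fi.
move=> eqF; apply: (mulfI (natr_neq0 i)); rewrite mulr_natl.
apply: (addIr ('C(m, i)%:R *+ i)); rewrite eqF -[_ *+ i]mulr_natr -!natrM -natrD mul_bin_left.
rewrite [('C(m, i) * i)%N]mulnC -mulnDl.
have [im|mi] := leqP i m; first by rewrite subnK.
by rewrite bin_small// !muln0.
Qed.

End ExpLogPolynomials.

(** * The Gauss norm *)

Section GaussNorm.
Context {R : realType} {K : ultrametricFieldType R}.
Variable r : R.
Hypothesis r_gt0 : 0 < r.
Implicit Types (B : R) (P Q : {poly K}).

(** The Gauss norm is the supremum of |P_i| r^i; an upper bound B replaces it,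
    so that no supremum has to be formed. *)
Definition gauss_le B P := forall i, absv P`_i * r ^+ i <= B.

Lemma gauss_le_ge0 B P : gauss_le B P -> 0 <= B.
Proof.
by move=> /(_ 0%N); apply: le_trans; rewrite mulr_ge0 ?absv_ge0 ?exprn_ge0 ?ltW.
Qed.

Lemma gauss_leD B P Q : gauss_le B P -> gauss_le B Q -> gauss_le B (P + Q).
Proof.
move=> PB QB i; rewrite coefD -ler_pdivlMr ?exprn_gt0//.
by apply: absvD_le; rewrite ler_pdivlMr ?exprn_gt0.
Qed.

Lemma gauss_le_sum (I : Type) (s : seq I) B (P : I -> {poly K}) :
  0 <= B -> (forall i, gauss_le B (P i)) -> gauss_le B (\sum_(i <- s) P i).
Proof.
move=> B0 PB; elim/big_ind: _ => // [i|]; last exact: gauss_leD.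
by rewrite coef0 absv0 mul0r.
Qed.

Lemma gauss_leM B C P Q :
  gauss_le B P -> gauss_le C Q -> gauss_le (B * C) (P * Q).
Proof.
move=> PB QC i; rewrite coefM -ler_pdivlMr ?exprn_gt0//.
apply: absv_sum_le => [|j _].
  rewrite !mulr_ge0 ?(gauss_le_ge0 PB) ?(gauss_le_ge0 QC)//.
  by rewrite invr_ge0 exprn_ge0 ?ltW.
rewrite absvM ler_pdivlMr ?exprn_gt0//.
rewrite -[X in r ^+ X](subnKC (ltn_ord j : (j <= i)%N)) exprD mulrACA.
by apply: ler_pM => //; rewrite mulr_ge0 ?absv_ge0 ?exprn_ge0 ?ltW.
Qed.

Lemma gauss_leZ B C (c : K) P :
  absv c <= B -> gauss_le C P -> gauss_le (B * C) (c *: P).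
Proof.
move=> cB PC i; rewrite coefZ absvM -mulrA.
by rewrite ler_pM ?absv_ge0// mulr_ge0 ?absv_ge0 ?exprn_ge0 ?ltW.
Qed.

Lemma gauss_le1 : gauss_le 1 1.
Proof.
by case=> [|i]; rewrite coef1/= ?absv1 ?absv0 ?mul0r// mul1r.
Qed.

Lemma gauss_leX B P n : gauss_le B P -> gauss_le (B ^+ n) (P ^+ n).
Proof.
move=> PB; elim: n => [|n IHn]; first exact: gauss_le1.
by rewrite !exprS; apply: gauss_leM.
Qed.

Lemma gauss_le_Xn n : gauss_le (r ^+ n) 'X^n.
Proof.
move=> i; rewrite coefXn; case: eqP => [->|_]; first by rewrite absv1 mul1r.
by rewrite absv0 mul0r exprn_ge0 ?ltW.
Qed.

(** Each monomial of degree at least N gains the factor (|x| / r)^N over its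
    bound at radius r. *)
Lemma absv_horner_le B P N (x : K) : gauss_le B P ->
    (forall i, (i < N)%N -> P`_i = 0) -> absv x <= r ->
  absv P.[x] <= B * (absv x / r) ^+ N.
Proof.
move=> PB P0 xr; have B0 := gauss_le_ge0 PB.
have c0 : 0 <= absv x / r by rewrite divr_ge0 ?absv_ge0 ?ltW.
rewrite horner_coef absv_sum_le ?mulr_ge0 ?exprn_ge0// => i _.
have [iN|Ni] := ltnP i N.
  by rewrite P0// mul0r absv0 mulr_ge0 ?exprn_ge0.
rewrite absvM absvX -[absv x in leLHS](divfK (lt0r_neq0 r_gt0)) exprMn.
rewrite mulrCA mulrC ler_pM ?exprn_ge0//.
  by rewrite mulr_ge0 ?absv_ge0 ?exprn_ge0 ?ltW.
by rewrite ler_wiXn2l// ler_pdivrMr// mul1r.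
Qed.

End GaussNorm.

(** * Powers as exponentials of logarithms *)

Section ExpLog.
Context {R : realType} {K : ultrametricFieldType R}.
Hypothesis K_complete :
  forall F : set_system K, ProperFilter F -> cauchy F -> cvg F.
Variable r : R.
Hypotheses (r_gt0 : 0 < r) (r_lt1 : r < 1).
Hypothesis fact_ge : forall n, r ^+ n <= absv (n.+1`!%:R : K).
Implicit Types (x y z : K) (m n N : nat).

Let nat_ge n : r ^+ n <= absv (n.+1%:R : K).
Proof.
rewrite (le_trans (fact_ge n))// factS natrM absvM ler_piMr ?absv_ge0//.
exact: absv_nat_le1.
Qed.

Let natr_neq0 n : n.+1%:R != 0 :> K.
Proof.
rewrite -(absv_eq0 (s:=K)) gt_eqF// (lt_le_trans _ (nat_ge n))//.
by rewrite exprn_gt0.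
Qed.

Lemma gauss_le_log_trunc n : gauss_le r r (log_trunc n : {poly K}).
Proof.
apply: gauss_le_sum => [||k] //; first exact: ltW.
have rE : r = (r ^+ k)^-1 * r ^+ k.+1.
  by rewrite exprS mulrCA mulVf ?mulr1// expf_neq0// lt0r_neq0.
rewrite {2}rE; apply: gauss_leZ => //; last exact: gauss_le_Xn.
by rewrite absvM absv_sign mul1r absvV lef_pV2 ?posrE ?exprn_gt0 ?nat_ge//
  (lt_le_trans _ (nat_ge k))// exprn_gt0.
Qed.

(** The bounds r for the logarithm and r^-k for 1/k! compensate each other. *)
Lemma gauss_le_exp_log_trunc m n :
  gauss_le r 1 (exp_trunc n.+1 (m%:R *: log_trunc n) : {poly K}).
Proof.
apply: gauss_le_sum => // k.
case: k => [[|k] ?] /=.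
  by rewrite fact0 invr1 expr0 scale1r; apply: gauss_le1.
have k1 : 0 < absv (k.+1`!%:R : K) :> R.
  by rewrite (lt_le_trans _ (fact_ge k))// exprn_gt0.
have kr : absv ((k.+1`!%:R : K)^-1) <= (r ^+ k.+1)^-1.
  rewrite absvV lef_pV2 ?posrE ?exprn_gt0// (le_trans _ (fact_ge k))//.
  by rewrite ler_wiXn2l// ltW.
rewrite -[X in gauss_le _ X](mulVf (expf_neq0 k.+1 (lt0r_neq0 r_gt0))).
apply: gauss_leZ => //; apply: gauss_leX => //.
rewrite -[X in gauss_le _ X]mul1r; apply: gauss_leZ => //.
  exact: absv_nat_le1.
exact: gauss_le_log_trunc.
Qed.

Lemma gauss_le_1DXn m : gauss_le r 1 ((1 + 'X) ^+ m : {poly K}).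
Proof.
rewrite -(expr1n _ m); apply: gauss_leX => //; apply: gauss_leD => //.
  exact: gauss_le1.
move=> i; apply: le_trans (gauss_le_Xn r_gt0 1 i) _.
by rewrite expr1 ltW.
Qed.

(** The two polynomials agree up to degree n and both have Gauss norm at most 1,
    so only the tail contributes. *)
Lemma exp_log_trunc_approx m n x : absv x <= r ->
  absv ((exp_trunc n.+1 (m%:R *: log_trunc n)).[x] - (1 + x) ^+ m)
    <= (absv x / r) ^+ n.+1.
Proof.
move=> xr; rewrite -[leRHS]mul1r.
have -> : (1 + x) ^+ m = ((1 + 'X) ^+ m).[x].
  by rewrite horner_exp !hornerE.
rewrite -hornerN -hornerD; apply: absv_horner_le => // [|i].
  apply: gauss_leD => //; first exact: gauss_le_exp_log_trunc.
  by move=> i; rewrite coefN absvN; apply: gauss_le_1DXn.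
rewrite ltnS coefB => /(coef_exp_log_trunc natr_neq0) ->.
have -> : (1 + 'X) ^+ m = \poly_(j < m.+1) ('C(m, j)%:R : K).
  rewrite addrC exprD1n poly_def; apply: eq_bigr => j _.
  by rewrite scaler_nat.
rewrite coef_poly; case: ltnP => [_|mi]; first by rewrite subrr.
by rewrite bin_small// subrr.
Qed.

Definition exp_sum n z : K := \sum_(k < n) z ^+ k / k`!%:R.

Definition log_sum n x : K := \sum_(k < n) (-1) ^+ k * x ^+ k.+1 / k.+1%:R.

Lemma horner_exp_log_trunc m n x :
  (exp_trunc n.+1 (m%:R *: log_trunc n)).[x] = exp_sum n.+1 (m%:R * log_sum n x).
Proof.
rewrite /exp_trunc /exp_sum horner_sum; apply: eq_bigr => k _.
rewrite hornerZ horner_exp hornerZ mulrC /log_trunc horner_sum /log_sum.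
congr ((_ * _) ^+ _ / _); apply: eq_bigr => j _.
by rewrite hornerZ hornerXn mulrAC.
Qed.

(** Uniformity in n is what allows log_sum to be replaced by its limit inside a
    partial sum of the same length. *)
Lemma exp_sum_lipschitz n y z : absv y <= r -> absv z <= r ->
  absv (exp_sum n y - exp_sum n z) <= absv (y - z) :> R.
Proof.
move=> yr zr; rewrite -sumrB absv_sum_le ?absv_ge0// => -[[|k] ?] _ /=.
  by rewrite subrr absv0 absv_ge0.
rewrite -mulrBl absvM absvV ler_pdivrMr.
  by rewrite (le_trans (absv_subX_le _ yr zr))// ler_wpM2l ?absv_ge0.
by rewrite (lt_le_trans _ (fact_ge k))// exprn_gt0.
Qed.

Lemma log_sum_is_cvg x : absv x < r ->
  exists2 l, (fun n => log_sum n x) @ \oo --> l &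
    absv l <= r /\ forall n, absv (log_sum n x) <= r.
Proof.
move=> xr; have c1 : `|absv x / r| < 1.
  by rewrite ger0_norm ?divr_ge0 ?absv_ge0 ?ltW// ltr_pdivrMr// mul1r.
have term_le k :
    absv ((-1) ^+ k * x ^+ k.+1 / k.+1%:R) <= absv x * (absv x / r) ^+ k.
  rewrite absvM absvM absv_sign mul1r absvX absvV exprS -mulrA.
  rewrite ler_wpM2l ?absv_ge0// exprMn exprVn ler_wpM2l ?exprn_ge0 ?absv_ge0//.
  by rewrite lef_pV2 ?posrE ?exprn_gt0// (lt_le_trans _ (nat_ge k))// exprn_gt0.
have sum_le n : absv (log_sum n x) <= r.
  apply: absv_sum_le => [|k _]; first exact: ltW.
  rewrite (le_trans (term_le _))// (le_trans _ (ltW xr))//.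
  rewrite ler_piMr ?absv_ge0// exprn_ile1 ?divr_ge0 ?absv_ge0 ?ltW//.
  by rewrite ltr_pdivrMr// mul1r.
have cvgl : cvgn (fun n => log_sum n x).
  apply: (absv_is_cvg (e := fun n => absv x * (absv x / r) ^+ n)) => // [n|].
    by rewrite /log_sum big_ord_recr /= addrAC subrr add0r.
  by rewrite -[X in _ --> X](mulr0 (absv x)); apply: cvgMr; apply: cvg_expr.
by exists (limn (fun n => log_sum n x)) => //; split=> //; apply: absv_cvg_le cvgl _.
Qed.

Lemma exp_log_cvg m x (l : K) : absv x < r ->
  (fun n => log_sum n x) @ \oo --> l -> 
  (fun n => exp_sum n (m%:R * l)) @ \oo --> (1 + x) ^+ m.
Proof.
move=> xr cvgl; have [l' cvgl' [l'r log_le]] := log_sum_is_cvg xr.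
have {l' cvgl' l'r}lr : absv l <= r.
  by rewrite -(absv_limn cvgl) (absv_limn cvgl').
have mle z : absv z <= r -> absv (m%:R * z) <= r.
  by move=> zr; rewrite absvM -[leRHS]mul1r ler_pM ?absv_ge0 ?absv_nat_le1.
rewrite -cvg_shiftS.
apply: (absv_cvg_bound
  (e := fun n => absv (log_sum n x - l) + (absv x / r) ^+ n.+1)) => [n|].
  rewrite -(subrKA (exp_sum n.+1 (m%:R * log_sum n x))).
  rewrite (le_trans (absvD_triangle _ _))// lerD//.
    rewrite absv_distC (le_trans (exp_sum_lipschitz _ _ _)) ?mle//.
    by rewrite -mulrBr absvM ler_piMl ?absv_ge0 ?absv_nat_le1.
  by rewrite -horner_exp_log_trunc exp_log_trunc_approx ?ltW.
rewrite -[0]addr0; apply: cvgD; first exact/cvg_absvP.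
rewrite (cvg_shiftS (fun n => (absv x / r) ^+ n)); apply: cvg_expr.
by rewrite ger0_norm ?divr_ge0 ?absv_ge0 ?ltW// ltr_pdivrMr// mul1r.
Qed.

Lemma qpow_nat (q : K) m : absv (1 - q) < r -> qpow q m%:R = q ^+ m.
Proof.
rewrite absv_distC => qr; have [l cvgl _] := log_sum_is_cvg qr.
have logE : padic_log q = l.
  apply: absv_limn; rewrite -cvg_shiftS.
  rewrite [X in X @ _](_ : _ = fun n => log_sum n (q - 1))//.
  apply/funext => n; rewrite /= big_add1 big_mkord; apply: eq_bigr => k _.
  by rewrite 2!(exprS (-1)) mulN1r mulN1r opprK.
rewrite /qpow /padic_exp logE -[q in RHS](subrKC 1).
apply: absv_limn.
rewrite [X in X @ _](_ : _ = fun n => exp_sum n (m%:R * l)).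
  exact: exp_log_cvg.
by apply/funext => n; rewrite /series /= big_mkord.
Qed.

End ExpLog.

(** * Alternating sums over p^N consecutive integers *)

Section AlternatingSums.
Context {R : realType} {K : ultrametricFieldType R}.
Hypothesis K_complete :
  forall F : set_system K, ProperFilter F -> cauchy F -> cvg F.
Variables (p : nat) (rho : R).
Hypotheses (p_odd : odd p) (rho_ge0 : 0 <= rho) (rho_lt1 : rho < 1).
Implicit Types (f g u : nat -> K) (x y N : nat).

Definition alt_sum f N : K := \sum_(x < p ^ N) (-1) ^+ x * f x.

Definition alt_lim f : K := limn (alt_sum f).

(** For rho = 1/p these are the 1-Lipschitz functions from Z_p to the unit ball,
    restricted to the natural numbers, which determine them by density. *)
Definition padic_lip f :=
  (forall x, absv (f x) <= 1 :> R) /\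
  forall N x, absv (f (x + p ^ N)%N - f x) <= rho ^+ N.

Lemma cvg_rhoX : (fun N => rho ^+ N) @ \oo --> (0 : R).
Proof. by apply: cvg_expr; rewrite ger0_norm. Qed.

Lemma rhoX_ge0 N : 0 <= rho ^+ N. Proof. exact: exprn_ge0. Qed.

Lemma sign_powp N : (-1) ^+ (p ^ N) = -1 :> K.
Proof. by rewrite -signr_odd oddX p_odd orbT expr1. Qed.

Lemma padic_lipM f g :
  padic_lip f -> padic_lip g -> padic_lip (fun x => f x * g x).
Proof.
move=> [f1 fN] [g1 gN]; split=> [x|N x]; first exact: absvM_le1.
exact: absv_subM_le.
Qed.

Lemma padic_lip_cst (c : K) : absv c <= 1 :> R -> padic_lip (fun=> c).
Proof. by move=> c1; split=> // N x; rewrite subrr absv0 rhoX_ge0. Qed.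

Lemma padic_lipB f g :
  padic_lip f -> padic_lip g -> padic_lip (fun x => f x - g x).
Proof.
move=> [f1 fN] [g1 gN]; split=> [x|N x]; first exact: absvB_le.
have -> : f (x + p ^ N)%N - g (x + p ^ N)%N - (f x - g x) =
    (f (x + p ^ N)%N - f x) - (g (x + p ^ N)%N - g x) by ring.
exact: absvB_le.
Qed.

Lemma padic_lipX f n : padic_lip f -> padic_lip (fun x => f x ^+ n).
Proof.
move=> fP; elim: n => [|n IHn]; first by apply: padic_lip_cst; rewrite absv1.
under eq_fun do rewrite exprS; exact: padic_lipM.
Qed.

Lemma padic_lip_shift f : padic_lip f -> padic_lip (fun x => f x.+1).
Proof. by move=> [f1 fN]; split=> // N x; rewrite -addSn. Qed.

(** Since p is odd, the p blocks of length p^N carry alternating signs that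
    add up to 1, so that all but one cancel up to rho^N. *)
Lemma alt_sum_step f N :
  padic_lip f -> absv (alt_sum f N.+1 - alt_sum f N) <= rho ^+ N.
Proof.
move=> [_ fN]; rewrite /alt_sum expnS; set P := (p ^ N)%N.
pose T m : K := \sum_(x < m) (-1) ^+ x * f x.
have fj j x : absv (f (j * P + x)%N - f x) <= rho ^+ N.
  elim: j => [|j IHj]; first by rewrite mul0n subrr absv0 rhoX_ge0.
  rewrite -(subrKA (f (j * P + x)%N)) absvD_le//.
  by rewrite mulSn -addnA addnC fN.
(* (odd j)%:R is the sum of the signs of the first j blocks. *)
suff H j : absv (T (j * P)%N - (odd j)%:R * T P) <= rho ^+ N.
  by have := H p; rewrite p_odd mul1r.
elim: j => [|j IHj]; first by rewrite mul0n /T big_ord0 mul0r subrr absv0 rhoX_ge0.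
have Tj : absv (T (j.+1 * P)%N - (T (j * P)%N + (-1) ^+ j * T P)) <= rho ^+ N.
  rewrite mulSnr /T big_split_ord /= opprD addrA [X in X - _]addrAC subrr add0r.
  rewrite mulr_sumr -sumrB absv_sum_le ?rhoX_ge0// => x _.
  rewrite exprD mulnC exprM sign_powp mulrA -mulrBr absvM -exprD absv_sign.
  by rewrite mul1r mulnC.
rewrite -(subrKA (T (j * P)%N + (-1) ^+ j * T P)) absvD_le//.
have -> : T (j * P)%N + (-1) ^+ j * T P - (odd j.+1)%:R * T P =
    T (j * P)%N - (odd j)%:R * T P.
  by rewrite -signr_odd /=; case: (odd j); rewrite /= ?expr1 ?expr0; ring.
by [].
Qed.

Lemma alt_sum_cvg f : padic_lip f -> alt_sum f @ \oo --> alt_lim f.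
Proof.
move=> fP; apply: (absv_is_cvg K_complete _ cvg_rhoX) => N.
exact: alt_sum_step.
Qed.

Lemma alt_lim_sum (I : Type) (s : seq I) (c : I -> K) (f : I -> nat -> K) :
  (forall i, padic_lip (f i)) ->
  alt_lim (fun x => \sum_(i <- s) c i * f i x) =
  \sum_(i <- s) c i * alt_lim (f i).
Proof.
move=> fP; apply: absv_limn.
rewrite [X in X @ _](_ : _ = fun N => \sum_(i <- s) c i * alt_sum (f i) N).
  by apply: absv_cvg_sum => i; apply/absv_cvgZ/alt_sum_cvg.
apply/funext => N; rewrite /alt_sum.
under [RHS]eq_bigr do rewrite mulr_sumr.
rewrite exchange_big /=; apply: eq_bigr => x _.
by rewrite mulr_sumr; apply: eq_bigr => i _; rewrite mulrCA.
Qed.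

(** The sum of (-1)^x f(x) over 0 <= x <= p^N can be split off at either end, and
    f(p^N) tends to f(0). *)
Lemma alt_lim_shift f : padic_lip f ->
  alt_lim (fun x => f x.+1) = 2 * f 0%N - alt_lim f.
Proof.
move=> fP; apply: absv_limn.
rewrite [X in X @ _](_ : _ = fun N => (f 0%N + f (p ^ N)%N) - 1 * alt_sum f N).
  rewrite -[alt_lim f]mul1r; under eq_fun do rewrite -mulNr.
  rewrite -mulNr; apply: absv_cvgD; last exact/absv_cvgZ/alt_sum_cvg.
  rewrite mulr_natl mulr2n; apply: absv_cvgD; first exact: cvg_cst.
  by apply: (absv_cvg_bound _ cvg_rhoX) => N; rewrite -{1}[(p ^ N)%N]add0n fP.2.
apply/funext => N; rewrite mul1r /alt_sum.
have E : f 0%N - \sum_(x < p ^ N) (-1) ^+ x * f x.+1 =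
    \sum_(x < p ^ N) (-1) ^+ x * f x - f (p ^ N)%N.
  transitivity (\sum_(x < (p ^ N).+1) (-1) ^+ x * f x : K).
    rewrite big_ord_recl /= expr0 mul1r -sumrN; congr (_ + _).
    by apply: eq_bigr => x _; rewrite exprS mulN1r mulNr.
  by rewrite big_ord_recr /= sign_powp mulN1r.
by rewrite -[LHS](subKr (f 0%N)) E; ring.
Qed.

(** The hypothesis says that g(y) = f(-1-y): as x + y + 1 = p^N tends to 0, y
    tends to -1 - x.  Stating it on natural numbers avoids evaluating f at
    negative integers. *)
Lemma alt_lim_reflect f g : padic_lip g ->
  (forall N x y, (x + y).+1 = (p ^ N)%N -> absv (f x - g y) <= rho ^+ N) ->
  alt_lim f = alt_lim g.
Proof.
move=> gP fg; apply: absv_limn.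
rewrite [X in X @ _](_ : _ = fun N => alt_sum g N + (alt_sum f N - alt_sum g N)).
  rewrite -[X in _ --> X]addr0; apply: absv_cvgD; first exact: alt_sum_cvg.
  apply: (absv_cvg_bound _ cvg_rhoX) => N; rewrite subr0.
  rewrite /alt_sum (reindex_inj rev_ord_inj) -sumrB /=.
  apply: absv_sum_le => [|x _]; first exact: rhoX_ge0.
  have xE : (p ^ N - x.+1 + x).+1 = (p ^ N)%N by rewrite -addnS subnK.
  have -> : (-1) ^+ (p ^ N - x.+1) = (-1) ^+ x :> K.
    have := sign_powp N; rewrite -[in LHS]xE exprS exprD mulN1r => /oppr_inj sE.
    by apply: (can_inj (signrMK x)); rewrite mulrC sE -expr2 sqrr_sign.
  by rewrite -mulrBr absvM absv_sign mul1r fg.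
by apply/funext => N; rewrite addrC subrK.
Qed.

End AlternatingSums.

(** * q-integers and their reflection *)

Section QIntegers.
Context {R : realType} {K : ultrametricFieldType R}.
Variables (p : nat) (rho : R).
Hypotheses (p_odd : odd p) (rho_ge0 : 0 <= rho) (rho_lt1 : rho < 1).
Hypothesis absvp_le : absv (p%:R : K) <= rho.
Implicit Types (q a : K) (x y N n : nat).

(** Unlike the quotient (1 - q^n) / (1 - q), the sum needs no separate case for
    q = 1. *)
Definition qint q n : K := \sum_(i < n) q ^+ i.

Lemma qintD q x y : qint q (x + y) = qint q x + q ^+ x * qint q y.
Proof.
rewrite /qint big_split_ord /= mulr_sumr; congr (_ + _).
by apply: eq_bigr => i _; rewrite exprD.
Qed.

Lemma qintM q x y : qint q (x * y) = qint q x * qint (q ^+ x) y.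
Proof.
elim: y => [|y IHy]; first by rewrite muln0 /qint !big_ord0 mulr0.
rewrite mulnSr qintD IHy [qint (q ^+ x) y.+1]/qint big_ord_recr /= -/(qint _ _).
by rewrite mulrDr -exprM mulrC; congr (_ + _); rewrite mulrC.
Qed.

Lemma expr_qint q n : q ^+ n - 1 = (q - 1) * qint q n.
Proof. exact: subrX1. Qed.

Section Unit.
Variable q : K.
Hypothesis q_near1 : absv (1 - q) <= rho.

Lemma absv_near1 : absv q = 1 :> R.
Proof. by rewrite -[q](subrKC 1) absv_1D// absv_distC (le_lt_trans q_near1). Qed.

Lemma near1_neq0 : q != 0.
Proof. by rewrite -(absv_eq0 (s:=K)) absv_near1 oner_eq0. Qed.

Lemma absv_qint_le1 n : absv (qint q n) <= 1 :> R.
Proof. by apply: absv_sum_le => // i _; rewrite absvX absv_near1 expr1n. Qed.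

Lemma expr_near1 n : absv (1 - q ^+ n) <= rho.
Proof.
rewrite absv_distC expr_qint absvM -[leRHS]mulr1 ler_pM ?absv_ge0//.
  by rewrite absv_distC.
exact: absv_qint_le1.
Qed.

End Unit.

(** In the factorization [p^N]_q = [p]_q [p]_(q^p) [p]_(q^(p^2)) ... each of the
    N factors differs from p by at most |1 - q|. *)
Lemma absv_qint_powp q N : absv (1 - q) <= rho ->
  absv (qint q (p ^ N)) <= rho ^+ N.
Proof.
move=> q1; elim: N => [|N IHN]; first exact: absv_qint_le1.
rewrite expnSr qintM absvM exprSr ler_pM ?absv_ge0//.
move: (q ^+ _) (expr_near1 q1 (p ^ N)) => Q Q1.
rewrite -(subrK p%:R (qint Q p)) absvD_le//.
rewrite -[p in p%:R]card_ord -sumr_const -sumrB absv_sum_le// => i _.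
by rewrite absv_distC expr_near1.
Qed.

Lemma absv_expr_powp q N : absv (1 - q) <= rho ->
  absv (q ^+ (p ^ N) - 1) <= rho ^+ N.
Proof.
move=> q1; rewrite expr_qint absvM -[leRHS]mul1r ler_pM ?absv_ge0//.
  by rewrite absv_distC (le_trans q1) ?ltW.
exact: absv_qint_powp.
Qed.

Lemma padic_lip_expr q : absv (1 - q) <= rho ->
  padic_lip p rho (fun x => q ^+ x).
Proof.
move=> q1; split=> [x|N x]; first by rewrite absvX (absv_near1 q1) expr1n.
rewrite exprD -[X in _ - X]mulr1 -mulrBr absvM absvX (absv_near1 q1) expr1n.
by rewrite mul1r absv_expr_powp.
Qed.

Lemma padic_lip_qint q : absv (1 - q) <= rho -> padic_lip p rho (qint q).
Proof.
move=> q1; split=> [x|N x]; first exact: absv_qint_le1.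
rewrite qintD addrAC subrr add0r absvM absvX (absv_near1 q1) expr1n.
by rewrite mul1r absv_qint_powp.
Qed.

Lemma absv_1BV q : absv (1 - q) <= rho -> absv (1 - q^-1) = absv (1 - q) :> R.
Proof.
move=> q1; have q0 := near1_neq0 q1.
have -> : 1 - q^-1 = (q - 1) * q^-1 by rewrite mulrBl mulfV// mul1r.
by rewrite absvM absvV (absv_near1 q1) invr1 mulr1 absv_distC.
Qed.

Lemma inv_near1 q : absv (1 - q) <= rho -> absv (1 - q^-1) <= rho.
Proof. by move=> q1; rewrite absv_1BV. Qed.

(** If p^N is replaced by 0, then x = -1 - y and this is the identity
    1 - [x]_q = [1 - x]_{1/q}. *)
Lemma qint_reflect q N x y : absv (1 - q) <= rho -> (x + y).+1 = (p ^ N)%N ->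
  absv (1 - qint q x - qint q^-1 y.+2) <= rho ^+ N.
Proof.
move=> q1 xyN; have q0 := near1_neq0 q1.
(* [y+1]_(1/q) is [y+1]_q with its terms in reverse order, up to a power of q. *)
have revE : qint q^-1 y.+2 = 1 + q^-1 ^+ y.+1 * qint q y.+1.
  rewrite /qint big_ord_recl expr0 mulr_sumr (reindex_inj rev_ord_inj) /=.
  congr (_ + _); apply: eq_bigr => -[i /= iy] _; rewrite /bump /= add1n subSS.
  rewrite -[in RHS](subnK (iy : (i <= y)%N)) -addSn exprD -mulrA -exprMn.
  by rewrite mulVf// expr1n mulr1.
have P : qint q (p ^ N) = qint q x + q ^+ x * qint q y.+1.
  by rewrite -xyN -addnS qintD.
have qx : q^-1 ^+ y.+1 * (1 - q) * qint q (p ^ N) = q^-1 ^+ y.+1 - q ^+ x.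
  rewrite -mulrA -opprB mulNr -expr_qint opprB mulrBr mulr1 -xyN -addnS exprD.
  by rewrite mulrCA -exprMn mulVf// expr1n mulr1.
have -> : 1 - qint q x - qint q^-1 y.+2 =
    - (qint q (p ^ N) + q^-1 ^+ y.+1 * (1 - q) * qint q (p ^ N) * qint q y.+1).
  by rewrite qx revE P; ring.
rewrite absvN absvD_le ?absv_qint_powp//.
rewrite mulrAC absvM -[leRHS]mul1r ler_pM ?absv_ge0 ?absv_qint_powp//.
rewrite !absvM_le1 ?absv_qint_le1//.
  by rewrite absvX (absv_near1 (inv_near1 q1)) expr1n.
by rewrite (le_trans q1) ?ltW.
Qed.

(** Replacing x by -1-x turns the left integrand into a u(x+2), where u is the
    right integrand; two shifts bring u(x+2) back to u(x) and leave the boundary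
    values u(0) = 0 and u(1) = 1/a.  In the application a is q^h. *)
Lemma alt_lim_qint_reflect q a n :
    (forall F : set_system K, ProperFilter F -> cauchy F -> cvg F) ->
    absv (1 - q) <= rho -> absv (1 - a) <= rho ->
  alt_lim p (fun x => a ^+ x * (1 - qint q x) ^+ n.+1) =
  2 + a * alt_lim p (fun x => a^-1 ^+ x * qint q^-1 x ^+ n.+1).
Proof.
move=> K_complete q1 a1; have a0 := near1_neq0 a1.
have Q1 := inv_near1 q1; have A1 := inv_near1 a1.
pose u x := a^-1 ^+ x * qint q^-1 x ^+ n.+1.
have uP : padic_lip p rho u.
  apply: padic_lipM; [exact: padic_lip_expr|apply: padic_lipX => //].
  exact: padic_lip_qint.
pose g y := a * u y.+2.
have gP : padic_lip p rho g.
  apply: padic_lipM; first by apply: padic_lip_cst; rewrite ?(absv_near1 a1).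
  exact: (padic_lip_shift (padic_lip_shift uP)).
rewrite (alt_lim_reflect (g := g) K_complete p_odd rho_ge0 rho_lt1 gP); last first.
  move=> N x y xyN; rewrite /g /u mulrA; apply: absv_subM_le.
  - rewrite absvX exprn_ile1 ?absv_ge0//.
    by rewrite absvB_le ?absv1// absv_qint_le1.
  - by rewrite absvM absvX (absv_near1 A1) (absv_near1 a1) expr1n mulr1.
  - rewrite exprS mulVKf//.
    have -> : a ^+ x - a^-1 ^+ y.+1 = a^-1 ^+ y.+1 * (a ^+ (p ^ N) - 1).
      rewrite -xyN -addnS exprD mulrBr mulr1 mulrCA -exprMn mulVf// expr1n.
      by rewrite mulr1.
    rewrite absvM absvX (absv_near1 A1) expr1n mul1r.
    exact: absv_expr_powp.
  - rewrite (le_trans (absv_subX_le (B := 1) _ _ _))//.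
    + by rewrite absvB_le ?absv1// absv_qint_le1.
    + exact: absv_qint_le1.
    by rewrite expr1n mulr1 qint_reflect.
have -> : alt_lim p g = a * alt_lim p (fun y => u y.+2).
  have := alt_lim_sum K_complete p_odd rho_ge0 rho_lt1 [:: tt] (fun=> a)
    (f := fun=> fun y => u y.+2) (fun=> padic_lip_shift (padic_lip_shift uP)).
  by rewrite big_seq1 => <-; congr (alt_lim p _); apply/funext => y; rewrite big_seq1.
have shift := alt_lim_shift K_complete p_odd rho_ge0 rho_lt1.
rewrite (shift _ (padic_lip_shift uP)) (shift _ uP).
have -> : u 0%N = 0 by rewrite /u /qint big_ord0 expr0n mulr0.
have -> : u 1%N = a^-1 by rewrite /u /qint big_ord1 expr0 expr1n mulr1 expr1.
by rewrite mulr0 sub0r opprK mulrDr mulrCA mulfV// mulr1.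
Qed.

End QIntegers.

(** * The fermionic integral and Genocchi numbers *)

Section FermionicIntegral.
Context {R : realType} {K : ultrametricFieldType R}.
Variables (p : nat) (rho : R).
Hypothesis K_complete :
  forall F : set_system K, ProperFilter F -> cauchy F -> cvg F.
Hypotheses (p_odd : odd p) (rho_ge0 : 0 <= rho) (rho_lt1 : rho < 1).
Hypotheses (absvp_le : absv (p%:R : K) <= rho) (absv2 : absv (2 : K) = 1 :> R).
Implicit Types (q : K) (h x N n : nat).

Let two_neq0 : (2 : K) != 0.
Proof. by rewrite -(absv_eq0 (s:=K)) absv2 oner_eq0. Qed.

Lemma absv_1D_near1 q : absv (1 - q) <= rho -> absv (1 + q) = 1 :> R.
Proof.
move=> q1; have -> : 1 + q = 2 * (1 + (q - 1) / 2) by field.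
rewrite absvM absv2 mul1r absv_1D// absvM absvV absv2 invr1 mulr1 absv_distC.
exact: le_lt_trans q1 _.
Qed.

Lemma qnum_neg_cvg q : absv (1 - q) <= rho ->
  (fun N => (qnum_neg q (p ^ N))^-1) @ \oo --> (1 + q) / 2.
Proof.
move=> q1; apply: (absv_cvg_bound _ (cvg_rhoX rho_ge0 rho_lt1)) => N.
have qN1 : absv (1 + q ^+ (p ^ N)) = 1 :> R.
  exact/absv_1D_near1/expr_near1.
have qN0 : 1 + q ^+ (p ^ N) != 0.
  by rewrite -(absv_eq0 (s:=K)) qN1 oner_eq0.
rewrite /qnum_neg exprNn sign_powp// mulN1r opprK invf_div -mulrBr absvM.
rewrite absv_1D_near1// mul1r.
have -> : (1 + q ^+ (p ^ N))^-1 - 2^-1 =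
    (1 - q ^+ (p ^ N)) / (2 * (1 + q ^+ (p ^ N))) by field; rewrite qN0 two_neq0.
rewrite absvM absvV absvM absv2 qN1 mulr1 invr1 mulr1 absv_distC.
exact: absv_expr_powp.
Qed.

Lemma fermionic_integralE q (f : K -> K) (g : nat -> K) :
    absv (1 - q) <= rho -> padic_lip p rho g ->
    (forall x, f x%:R * q ^+ x = g x) ->
  fermionic_integral p q f = (1 + q) / 2 * alt_lim p g.
Proof.
move=> q1 gP fg; apply: absv_limn.
apply: absv_cvgM; first exact: qnum_neg_cvg.
rewrite [X in X @ _](_ : _ = alt_sum p g); first exact: alt_sum_cvg gP.
apply/funext => N; rewrite big_mkord; apply: eq_bigr => x _.
by rewrite -mulrA fg.
Qed.

Lemma qnum_nat q n : (forall m, qpow q m%:R = q ^+ m) ->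
  qnum q n%:R = qint q n.
Proof.
move=> qpowE; rewrite /qnum; case: eqVneq => [->|q1].
  by rewrite /qint; under eq_bigr do rewrite expr1n; rewrite sumr_const card_ord.
by rewrite qpowE -opprB expr_qint -mulNr opprB mulrAC mulfV ?mul1r// subr_eq0 eq_sym.
Qed.

Lemma padic_lip_weighted q h (f : nat -> K) n : absv (1 - q) <= rho ->
  padic_lip p rho f -> padic_lip p rho (fun x => (q ^+ h) ^+ x * f x ^+ n).
Proof.
move=> q1 fP; apply: padic_lipM; last exact: padic_lipX.
exact/padic_lip_expr/expr_near1.
Qed.

Lemma genocchiE q h n : absv (1 - q) <= rho ->
    (forall m, qpow q m%:R = q ^+ m) -> (0 < h)%N ->
  genocchi p h n.+1 q =
  n.+1%:R * ((1 + q) / 2 * alt_lim p (fun x => (q ^+ h) ^+ x * qint q x ^+ n)).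
Proof.
move=> q1 qpowE h_gt0; rewrite /genocchi /=; congr (_ * _).
apply: fermionic_integralE => // [|x].
  exact/padic_lip_weighted/padic_lip_qint.
rewrite add0r qnum_nat// -(natrB _ h_gt0) -natrM qpowE mulrAC -exprD -exprM.
by rewrite -mulSnr subn1 prednK.
Qed.

(** Since 1 - [y]_q = [1 - y]_(1/q), the reflection exchanges q and 1/q; the
    term [2]_q comes from the boundary value of the shift. *)
Lemma integral_qint_compl q h n : absv (1 - q) <= rho ->
    (forall m, qpow q m%:R = q ^+ m) ->
    (forall m, qpow q^-1 m%:R = q^-1 ^+ m) ->
    (forall m, m.+1%:R != 0 :> K) -> (0 < h)%N ->
  (1 + q) / 2 * alt_lim p (fun x => (q ^+ h) ^+ x * (1 - qint q x) ^+ n.+1) =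
  qnum q 2%:R + q ^+ (h + 1) / n.+2%:R * genocchi p h n.+2 q^-1.
Proof.
move=> q1 qpowE qVpowE natr_neq0 h_gt0.
have q0 := near1_neq0 rho_lt1 q1.
rewrite (alt_lim_qint_reflect p_odd rho_ge0 rho_lt1 absvp_le _ K_complete)//;
  last exact: expr_near1.
rewrite genocchiE//; last exact: inv_near1.
rewrite qnum_nat// /qint !big_ord_recl big_ord0 expr0 expr1 addr0 exprVn.
move: (alt_lim _ _) => E; rewrite exprD expr1.
move: (n.+2%:R : K) (natr_neq0 n.+1) => c c_neq0.
by field; rewrite c_neq0 two_neq0 q0.
Qed.

End FermionicIntegral.

(** * The two binomial expansions *)

Lemma sum_binX_subr {A : comNzRingType} (w : A) (m a : nat) :
  \sum_(0 <= l < m.+1) 'C(m, l)%:R * (-1) ^+ l * w ^+ (l + a) =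
  w ^+ a * (1 - w) ^+ m.
Proof.
rewrite exprBn mulr_sumr big_mkord; apply: eq_bigr => l _.
by rewrite expr1n mulr1 exprD -mulr_natl; ring.
Qed.

Lemma sum_bin_subrX {A : comNzRingType} (w : A) (m a : nat) :
  \sum_(0 <= l < a.+1) 'C(a, l)%:R * (-1) ^+ (a + l) * (1 - w) ^+ (a + m - l) =
  w ^+ a * (1 - w) ^+ m.
Proof.
have -> : w ^+ a = (-1) ^+ a * ((1 - w) - 1) ^+ a.
  by rewrite -exprMn; congr (_ ^+ _); ring.
rewrite exprBn mulr_sumr mulr_suml big_mkord; apply: eq_bigr => l _.
have la : (l <= a)%N by rewrite -ltnS.
rewrite expr1n mulr1 [(a + m)%N]addnC -addnBA//.
by rewrite !exprD -mulr_natl; ring.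
Qed.

Lemma absz_sum_subn s (n : 'I_s -> nat) k : (s * k <= \sum_(d < s) n d)%N ->
  absz (\sum_(d < s) ((n d)%:Z - k%:Z)) = (\sum_(d < s) n d - s * k)%N.
Proof.
move=> kn; rewrite sumrB sumr_const card_ord -(big_morph Posz PoszD (erefl _)).
by rewrite -mulr_natl natz -PoszM subzn.
Qed.
Theorem theorem10 (p : nat) (p_prime : prime p) (p_odd : odd p)
    (R : realType) (Cp : ultrametricFieldType R)
    (Cp_spec : is_padic_complex p Cp)
    (q : Cp) (hq : absv (1 - q) < (p%:R : R) `^ (- (1 / (p%:R - 1))))
    (h : nat) (h_gt0 : (0 < h)%N)
    (s : nat) (s_ge2 : (2 <= s)%N)
    (n : 'I_s -> nat) (k : nat) (hn : (s * k < \sum_(d < s) n d)%N) :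
  \sum_(0 <= l < (\sum_(d < s) n d - s * k).+1)
      'C(absz (\sum_(d < s) ((n d)%:Z - k%:Z))%R, l)%:R * (-1) ^+ l
      * (genocchi p h (l + s * k + 1) q / (l + s * k + 1)%:R)
  = if k == 0%N then
      qnum q 2%:R
      + q ^+ (h + 1) / (\sum_(d < s) n d + 1)%:R
        * genocchi p h (\sum_(d < s) n d + 1) q^-1
    else
      \sum_(0 <= l < (s * k).+1)
        'C(s * k, l)%:R * (-1) ^+ (s * k + l)
        * (qnum q 2%:R
           + q ^+ (h + 1) / (\sum_(d < s) n d - l + 1)%:R
             * genocchi p h (\sum_(d < s) n d - l + 1) q^-1) :> Cp.
Proof.
have p_gt2 : (2 < p)%N by rewrite odd_prime_gt2.
have [absvp K_complete _ _] := Cp_spec.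
have absv2 : absv (2 : Cp) = 1 :> R.
  by rewrite (absv_nat_coprime p_prime absvp)// coprimen2.
set r : R := powR _ _ in hq.
have r_gt0 : 0 < r := exp_radius_gt0 p_prime.
have r_lt1 : r < 1 := exp_radius_lt1 p_prime.
(* rho bounds both |p| and |1 - q|, the two contributions to |[p]_q|. *)
pose rho := Num.max (p%:R^-1) (absv (1 - q)).
have rho_ge0 : 0 <= rho by rewrite le_max absv_ge0 orbT.
have rho_lt1 : rho < 1.
  by rewrite gt_max invp_lt1 ?(lt_trans hq).
have absvp_le : absv (p%:R : Cp) <= rho by rewrite absvp le_max lexx.
have q1 : absv (1 - q) <= rho by rewrite le_max lexx orbT.
have qpowE m : qpow q m%:R = q ^+ m.
  exact: (qpow_nat K_complete r_gt0 r_lt1 (absv_fact_ge p_prime absvp)).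
have qVpowE m : qpow q^-1 m%:R = q^-1 ^+ m.
  apply: (qpow_nat K_complete r_gt0 r_lt1 (absv_fact_ge p_prime absvp)).
  by rewrite (absv_1BV rho_lt1).
rewrite absz_sum_subn ?(ltnW hn)//.
set D := (\sum_(d < s) n d)%N in hn *; set a := (s * k)%N in hn *.
pose E (f : nat -> Cp) := (1 + q) / 2 * alt_lim p f.
have lipw f e : padic_lip p rho f ->
    padic_lip p rho (fun x => (q ^+ h) ^+ x * f x ^+ e).
  exact: padic_lip_weighted.
(* Both expansions are instances of the linearity of E, applied to a pointwise
   identity. *)
have intE f g m (c : nat -> Cp) e : padic_lip p rho f ->
    (forall x, \sum_(0 <= l < m) c l * f x ^+ e l = g x) ->
    \sum_(0 <= l < m) c l * E (fun x => (q ^+ h) ^+ x * f x ^+ e l) =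
    E (fun x => (q ^+ h) ^+ x * g x).
  move=> fP fg; under eq_bigr do rewrite mulrCA.
  rewrite -mulr_sumr -(alt_lim_sum K_complete p_odd rho_ge0 rho_lt1)//;
    last by move=> l; apply: lipw.
  congr (_ * alt_lim p _); apply/funext => x; rewrite -fg mulr_sumr.
  by apply: eq_bigr => l _; rewrite mulrCA.
have qintP : padic_lip p rho (qint q) by exact: padic_lip_qint.
have qcomplP : padic_lip p rho (fun x => 1 - qint q x).
  by apply: padic_lipB => //; apply: padic_lip_cst; rewrite ?absv1.
pose mid x := qint q x ^+ a * (1 - qint q x) ^+ (D - a).
transitivity (E (fun x => (q ^+ h) ^+ x * mid x)).
  rewrite -(intE (qint q) mid (D - a).+1
    (fun l => 'C(D - a, l)%:R * (-1) ^+ l) (fun l => (l + a)%N))//; last first.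
    by move=> x; rewrite sum_binX_subr.
  apply: eq_bigr => l _; congr (_ * _).
  rewrite addn1 (genocchiE K_complete p_odd rho_ge0)//.
  by rewrite mulrAC mulfV ?mul1r// (natr_neq0 p_prime absvp).
transitivity (\sum_(0 <= l < a.+1) 'C(a, l)%:R * (-1) ^+ (a + l) *
    (qnum q 2%:R +
     q ^+ (h + 1) / (D - l + 1)%:R * genocchi p h (D - l + 1) q^-1)).
  rewrite -(intE (fun x => 1 - qint q x) mid a.+1
    (fun l => 'C(a, l)%:R * (-1) ^+ (a + l)) (fun l => (D - l)%N))//; last first.
    move=> x; rewrite /mid -sum_bin_subrX.
    by under [RHS]eq_bigr do rewrite subnKC ?(ltnW hn)//.
  rewrite big_nat [RHS]big_nat; apply: eq_bigr => l /andP[_ la].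
  congr (_ * _); have Dl : (0 < D - l)%N by rewrite subn_gt0 (leq_trans la).
  rewrite [(D - l + 1)%N]addn1 /E; case: (D - l)%N Dl => // e _.
  rewrite (integral_qint_compl K_complete p_odd rho_ge0)// => m.
  exact: (natr_neq0 p_prime absvp).
case: eqP => [k0|//].
by rewrite /a k0 muln0 big_nat1 bin0 expr0 !mul1r subn0.
Qed.
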